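(* Let $f$ be an arbitrary real-valued function such that $f(x)\to\infty$ as $x\to\infty$. Then the collection \[ \Omega=\{\mathcal{S}(x,y) : f(x)\log x\leqslant y\leqslant x\} \] has the Erdős–Szemerédi property.
   Context: For real $x\geqslant y\geqslant 2$, $\mathcal{S}(x,y)=\{n\in\mathbb{Z}_{\geqslant 1} : n\leqslant x,\ P^+(n)\leqslant y\}$, where $P^+(n)$ denotes the largest prime factor of an integer $n\geqslant 2$ and $P^+(1)=1$. For a finite set $\mathcal{A}$ of integers, $\mathcal{A}+\mathcal{A}=\{a+a' : a,a'\in\mathcal{A}\}$ and $\mathcal{A}\cdot\mathcal{A}=\{aa' : a,a'\in\mathcal{A}\}$. An infinite collection $\Omega$ of finite sets has the Erdős–Szemerédi property if $\max\{|\mathcal{A}+\mathcal{A}|,|\mathcal{A}\cdot\mathcal{A}|\}=|\mathcal{A}|^{2+o(1)}$ as $|\mathcal{A}|\to\infty$ with $\mathcal{A}\in\Omega$; i.e., for every $\varepsilon>0$ there is $N$ such that every $\mathcal{A}\in\Omega$ with $|\mathcal{A}|\geqslant N$ satisfies $|\mathcal{A}|^{2-\varepsilon}\leqslant \max\{|\mathcal{A}+\mathcal{A}|,|\mathcal{A}\cdot\mathcal{A}|\}\leqslant |\mathcal{A}|^{2+\varepsilon}$. Here $\log$ is the natural logarithm, and only pairs with $y\geqslant 2$ are considered so that $\mathcal{S}(x,y)$ is defined. *)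

(* Defs.v *)
From HB Require Import structures.
From mathcomp Require Import all_boot all_order all_algebra finmap.
From mathcomp Require Import all_classical all_reals all_analysis.

Set Implicit Arguments.
Unset Strict Implicit.
Unset Printing Implicit Defensive.

Import Order.TTheory GRing.Theory Num.Theory.
Import numFieldNormedType.Exports.

Local Open Scope classical_set_scope.
Local Open Scope fset_scope.
Local Open Scope ring_scope.

(* [max_pdiv n] is the largest prime factor of n for n >= 2, and
   [max_pdiv 1 = 1], so it is exactly P^+. *)
Definition smooth_set (R : realType) (x y : R) : {fset int} :=
  [fset n%:Z | n in iota 1 (Num.truncn x) & (max_pdiv n)%:R <= y].

Lemma smooth_setP (R : realType) (x y : R) (z : int) :
  reflect [/\ 1 <= z, z%:~R <= x & (max_pdiv `|z|%N)%:R <= y]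
          (z \in smooth_set x y).
Proof.
have truncE n : (0 < n)%N -> (n <= Num.truncn x)%N = (n%:R <= x).
  move=> n0; have [x0|x0] := leP 0 x.
    by rewrite truncn_ge_nat.
  have -> : Num.truncn x = 0%N.
    by apply/Num.Theory.truncn0Pn; rewrite -ltNge (lt_trans x0).
  rewrite leqNgt n0; apply/esym/negbTE; rewrite -ltNge.
  by apply: lt_le_trans x0 _; rewrite ler0n.
apply: (iffP idP) => [/imfsetP[n /=]|[]].
  rewrite inE /= mem_iota add1n ltnS => /andP[/andP[n0]].
  by rewrite truncE // => nx ny ->; split.
case: z => // n; rewrite lez_nat /= => n0 nx ny.
apply/imfsetP; exists n => //=.
by rewrite inE /= mem_iota n0 add1n ltnS truncE //= nx.
Qed.

Definition sumset (A : {fset int}) : {fset int} :=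
  [fset a + b | a in A, b in A].

Definition prodset (A : {fset int}) : {fset int} :=
  [fset a * b | a in A, b in A].

(* The property max(|A + A|, |A . A|) = |A|^(2 + o(1)) as |A| -> oo, A in Omega.
   It holds vacuously when the sizes of the members of Omega are bounded. *)
Definition erdos_szemeredi (R : realType) (Omega : set {fset int}) : Prop :=
  forall e : R, 0 < e ->
  exists N : nat, forall A : {fset int}, Omega A -> (N <= #|` A|)%N ->
    let m : R := (maxn #|` sumset A| #|` prodset A|)%:R in
    (#|` A|)%:R `^ (2 - e) <= m /\ m <= (#|` A|)%:R `^ (2 + e).

Definition smooth_collection (R : realType) (f : R -> R) : set {fset int} :=
  [set A | exists x y : R,
     [/\ 2 <= y, f x * ln x <= y, y <= x & A = smooth_set x y]].

(* Main.v *)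
(** The product set alone is large. A product n of two elements of A = S(x, y)
    is at most x^2 and has at most tau(n) representations, so |A|^2 <= |A.A| D
    where D bounds tau on [1, x^2], and it suffices that D <= |A|^e. With
    L = ln x, the classical divisor bound gives D <= exp (5 L / ln L).
    On the other side put q = floor (min (y, L^2)) and k = floor (L / ln q).
    Products of k distinct primes up to q lie in A, so
    |A| >= 'C(pi(q), k) >= (pi(q) / k)^k, and Chebyshev's lower bound for pi(q)
    makes pi(q) / k at least K / 8 as soon as f x >= K and L >= K. The cut-off
    at L^2 ensures ln q <= 2 ln L, hence k >= L / (4 ln L): thus
    |A| >= exp ((L / (4 ln L)) ln (K / 8)), and K is chosen with
    e ln (K / 8) >= 20. *)
Require Import Defs.
From mathcomp Require Import all_boot all_order all_algebra finmap.
From mathcomp Require Import all_classical all_reals all_analysis.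
From mathcomp Require Import ring lra zify.
Import numFieldNormedType.Exports.


(** * Chebyshev's lower bound for the number of primes up to [q] *)

(** Terms of Legendre's formula with [p ^ k > n] vanish, so the sums for several factorials can
    share one range and be compared term by term. *)
Lemma logn_fact_extend p n N : prime p -> (n <= N)%N ->
  logn p n`! = (\sum_(1 <= k < N.+1) n %/ p ^ k)%N.
Proof.
move=> pp nN; rewrite logn_fact // [RHS](@big_cat_nat _ _ _ n.+1) //=.
rewrite -[LHS]addn0; congr addn; rewrite big_nat big1 // => k /andP[nk _].
by rewrite divn_small // (ltn_trans nk) // ltn_expl // prime_gt1.
Qed.

(** In Legendre's formula each [p ^ k] adds at most one carry to the exponent of [p], and none when
    [p ^ k > m + n]; so that exponent is at most [trunc_log p (m + n)]. *)
Lemma logn_bin_le p m n : prime p -> (0 < m + n)%N ->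
  (p ^ logn p 'C(m + n, m) <= m + n)%N.
Proof.
move=> pp N0; set N := (m + n)%N; set t := trunc_log p N.
apply: leq_trans (trunc_logP (prime_gt1 pp) N0).
rewrite leq_exp2l ?prime_gt1 // -/t.
have E : logn p N`! = (logn p 'C(N, m) + (logn p m`! + logn p n`!))%N.
  have := @bin_fact N m (leq_addr _ _); rewrite /N addKn => <-.
  by rewrite !lognM ?muln_gt0 ?fact_gt0 ?bin_gt0 ?leq_addr.
have cnt M : (\sum_(1 <= k < M.+1) (k <= t) <= t)%N.
  suff -> : (\sum_(1 <= k < M.+1) (k <= t) = minn M t)%N by rewrite geq_minr.
  elim: M => [|M IH]; first by rewrite big_geq // min0n.
  by rewrite big_nat_recr //= IH; case: (leqP M.+1 t); lia.
have H : (logn p N`! <= logn p m`! + logn p n`! + t)%N.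
  rewrite (@logn_fact_extend p m N) ?leq_addr // (@logn_fact_extend p n N) ?leq_addl //.
  rewrite logn_fact // -big_split /=.
  apply: leq_trans (leq_add (leqnn _) (cnt N)).
  rewrite -big_split /=; apply: leq_sum => k _.
  rewrite {1}/N divnD ?expn_gt0 ?prime_gt0 // leq_add2l.
  case le : (p ^ k <= _)%N => //; suff -> : (k <= t)%N by [].
  apply: trunc_log_max; first exact: prime_gt1.
  by apply: leq_trans le _; rewrite leq_add // leq_mod.
by move: H; rewrite E; lia.
Qed.

Lemma central_bin_ge m : (2 ^ m <= 'C(m.*2, m))%N.
Proof.
elim: m => [|m IH]; first by [].
have E : 'C(m.*2.+1, m) = 'C(m.*2.+1, m.+1).
  rewrite -bin_sub; last by lia.
  by congr binomial; lia.
by rewrite doubleS binS E expnS binS; lia.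
Qed.

Definition small_primes q := [set p : 'I_q.+1 | prime p].

(** With [m = q./2], the central binomial coefficient is at least [2 ^ m], and it is a product of at
    most pi(q) prime powers, each at most [m.*2 <= q]. *)
Lemma expn2_half_le_small_primes q : (0 < q)%N -> (2 ^ q./2 <= q ^ #|small_primes q|)%N.
Proof.
move=> q0; apply: leq_trans (central_bin_ge _) _.
set m := q./2; have mq : (m.*2 <= q)%N by rewrite /m; lia.
have C0 : (0 < 'C(m.*2, m))%N by rewrite bin_gt0; lia.
rewrite [X in (X <= _)%N]prod_prime_decomp // prime_decompE big_map /=.
have pow_le p : p \in primes 'C(m.*2, m) -> (p ^ logn p 'C(m.*2, m) <= m.*2)%N.
  rewrite mem_primes => /and3P[pp _ pC]; rewrite -addnn; apply: logn_bin_le => //.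
  case: (posnP (m + m)) => // m0; move: pC; have -> : m = 0 by lia.
  by rewrite dvdn1 => /eqP p1; rewrite p1 in pp.
have le : {subset primes 'C(m.*2, m) <= [seq val p | p in small_primes q]}.
  move=> p pC; have /and3P[pp _ _] : [&& prime p, (0 < 'C(m.*2, m))%N & p %| 'C(m.*2, m)].
    by rewrite -mem_primes.
  have pm : (p <= m.*2)%N.
    apply: leq_trans (pow_le _ pC).
    by rewrite -[X in (X <= _)%N]expn1 leq_exp2l ?prime_gt1 // logn_gt0.
  have pq : (p < q.+1)%N by lia.
  by apply/fintype.imageP; exists (Ordinal pq); rewrite // inE.
apply: leq_trans (_ : _ <= \prod_(p <- primes 'C(m.*2, m)) q)%N _; last first.
  rewrite big_const_seq count_predT iter_muln_1 leq_pexp2l //.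
  by have := uniq_leq_size (primes_uniq _) le; rewrite size_image.
by rewrite !big_seq; apply: leq_prod => p /pow_le /leq_trans; apply.
Qed.

(** * Many smooth numbers from products of distinct primes *)

(** After multiplication by k factorial, the factors compare one by one: n (k - i) <= k (n - i)
    because k <= n. *)
Lemma expn_bin_le n k : (k <= n)%N -> (n ^ k <= k ^ k * 'C(n, k))%N.
Proof.
move=> kn; rewrite -(@leq_pmul2r k`!) ?fact_gt0 // -mulnA bin_ffact.
rewrite -ffactnn !ffact_prod.
have cst a : (a ^ k = \prod_(i < k) a)%N by rewrite prod_nat_const card_ord.
rewrite !cst -!big_split; apply: leq_prod => i _ /=.
by rewrite !mulnBr [(n * k)%N]mulnC leq_sub2l // leq_mul2r kn orbT.
Qed.

Definition smooth_seq X y := [seq n <- iota 1 X | (max_pdiv n <= y)%N].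

Lemma mem_smooth_seq X y n :
  (n \in smooth_seq X y) = [&& (0 < n)%N, (n <= X)%N & (max_pdiv n <= y)%N].
Proof. by rewrite mem_filter mem_iota add1n ltnS andbC andbA. Qed.

(** A [k]-set of primes up to [q] is sent to its product; the map is injective because the set
    consists of the prime divisors of the product. *)
Lemma smooth_seq_ge_bin q k X y : (0 < q <= y)%N -> (q ^ k <= X)%N ->
  ('C(#|small_primes q|, k) <= size (smooth_seq X y))%N.
Proof.
move=> /andP[q0 qy] qX; rewrite -cards_draws.
set D := [set _ | _]; pose F (B : {set 'I_q.+1}) := (\prod_(p in B) (p : nat))%N.
have DP B : B \in D -> forall p : 'I_q.+1, p \in B -> prime p.
  by rewrite inE => /andP[/fintype.subsetP sB _] p /sB; rewrite inE.
have dvdF (B : {set 'I_q.+1}) r : B \in D -> prime r -> r %| F B ->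
    exists2 p, p \in B & r = val p.
  move=> BD rp; rewrite /F; elim/big_rec: _ => [|p a pB IH].
    by rewrite Euclid_dvd1.
  rewrite Euclid_dvdM // => /orP[|//]; rewrite dvdn_prime2 ?(DP B) //.
  by move=> /eqP ->; exists p.
have Finj : {in D &, injective F}.
  have sub B C : B \in D -> C \in D -> F B = F C -> B \subset C.
    move=> BD CD e; apply/fintype.subsetP => p pB.
    have : p %| F C by rewrite -e /F (bigD1 p) //= dvdn_mulr.
    by case/(dvdF _ _ CD (DP _ BD _ pB)) => r rC /val_inj ->.
  by move=> B C BD CD e; apply/eqP; rewrite finset.eqEsubset !sub.
rewrite cardE -(size_map F); apply: uniq_leq_size.
  by rewrite map_inj_in_uniq ?enum_uniq // => B C; rewrite !mem_enum; apply: Finj.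
move=> n /mapP[B]; rewrite mem_enum => BD -> {n}.
have F0 : (0 < F B)%N by rewrite prodn_cond_gt0 // => p /(DP _ BD) /prime_gt0.
rewrite mem_smooth_seq F0 /=; apply/andP; split.
  apply: leq_trans qX; have /eqP <- : #|B| == k by move: BD; rewrite inE => /andP[].
  rewrite -prod_nat_const; apply: leq_prod => p _.
  by rewrite -ltnS ltn_ord.
have [F1|F1] := leqP (F B) 1.
  by apply: leq_trans (leq_trans q0 qy); apply: leq_trans (max_pdiv_leq F0) F1.
have [p _ ->] := dvdF _ _ BD (max_pdiv_prime F1) (max_pdiv_dvd _).
by apply: leq_trans qy; rewrite -ltnS ltn_ord.
Qed.

(** * Divisor counts and their effect on product sets *)

Lemma size_divisors n : size (divisors n) = (\prod_(p <- primes n) (logn p n).+1)%N.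
Proof.
rewrite /divisors; have -> : (\prod_(p <- primes n) (logn p n).+1 =
    \prod_(f <- prime_decomp n) f.2.+1)%N by rewrite prime_decompE big_map.
elim: prime_decomp => [|[p e] s IH] /=; first by rewrite big_nil.
rewrite big_cons -IH /=; elim: e {IH} => [|e IH] /=; first by rewrite mul1n.
by rewrite size_merge size_cat size_map IH addnC -mulSn.
Qed.

(* Primes below T contribute at most b each; at a prime p >= T one uses a + 1 <= 2^a. *)
Lemma size_divisors_le n b T : (0 < n)%N -> (0 < b)%N -> (forall p, logn p n < b)%N ->
  exists2 e, (T ^ e <= n)%N & (size (divisors n) <= b ^ T * 2 ^ e)%N.
Proof.
(* The witness counts, with multiplicity, the prime factors that are at least [T]. *)
move=> n0 b0 nb; exists (\sum_(p <- primes n | (T <= p)%N) logn p n)%N.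
  rewrite [X in (_ <= X)%N](prod_prime_decomp n0) prime_decompE big_map /=.
  rewrite expn_sum big_mkcond /= !big_seq; apply: leq_prod => p.
  rewrite mem_primes => /and3P[pp _ _].
  case: ifP => [Tp|_]; last by rewrite expn_gt0 prime_gt0.
  by case: logn => // a; rewrite leq_exp2r.
rewrite size_divisors (bigID (fun p => T <= p)%N) /= mulnC leq_mul //.
  under eq_bigl do rewrite -ltnNge.
  apply: (@leq_trans (\prod_(p <- primes n | (p < T)%N) b)).
    by apply: leq_prod => p _; apply: nb.
  rewrite big_const_seq iter_muln_1 leq_pexp2l //.
  rewrite -size_filter -[X in (_ <= X)%N](size_iota 0).
  apply: uniq_leq_size; first by rewrite filter_uniq ?primes_uniq.
  by move=> p; rewrite mem_filter mem_iota add0n => /andP[].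
rewrite expn_sum; apply: leq_prod => p _; exact: ltn_expl.
Qed.

(** The pair (a, b) is recovered from (ab, a), where a is one of at most [D] divisors of ab. *)
Lemma size_sqr_le_prod (s : seq nat) D : uniq s -> (forall n, n \in s -> (0 < n)%N) ->
  (forall a b, a \in s -> b \in s -> (size (divisors (a * b)) <= D)%N) ->
  (size s ^ 2 <= size (undup [seq a * b | a <- s, b <- s]%N) * D)%N.
Proof.
move=> us s0 sD; set P := undup _.
pose pairs := [seq (a * b, a)%N | a <- s, b <- s].
have -> : (size s ^ 2)%N = size pairs by rewrite size_allpairs mulnn.
apply: (@leq_trans (size [seq (n, d) | n <- P, d <- divisors n])).
  apply: uniq_leq_size.
    apply: allpairs_uniq => // -[a b] [a' b'].
    move=> /allpairsP[[u v] /= [us1 vs1 [-> ->]]] /allpairsP[[u' v'] /= [us2 vs2 [-> ->]]].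
    move=> /= [e eu]; rewrite eu in e *; congr pair.
    by apply/eqP; rewrite -(eqn_pmul2l (s0 _ us2)) e.
  move=> _ /allpairsP[[a b] /= [sa sb ->]].
  have ab0 : (0 < a * b)%N by rewrite muln_gt0 !s0.
  apply/allpairsPdep; exists (a * b)%N, a; split=> //.
    by rewrite mem_undup; apply/allpairsP; exists (a, b).
  by rewrite -dvdn_divisors // dvdn_mulr.
rewrite size_allpairs_dep sumnE big_map -sum1_size big_distrl /= !big_seq.
apply: leq_sum => n; rewrite mem_undup => /allpairsP[[a b] /= [sa sb ->]].
by rewrite mul1n sD.
Qed.

(** * Real estimates: size of the smooth set and the divisor bound *)

Import Order.TTheory GRing.Theory Num.Theory.
Local Open Scope classical_set_scope.
Local Open Scope ring_scope.

Lemma ln2_ge_half (R : realType) : 2^-1 <= ln (2 : R).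
Proof.
have := @le_ln1Dx R (- 2^-1) ltac:(lra).
have -> : 1 - 2^-1 = (2 : R)^-1 by lra.
by rewrite lnV ?posrE //; lra.
Qed.

Lemma truncn_bounds (R : realType) (x : R) : 0 <= x ->
  (Num.truncn x)%:R <= x /\ x < (Num.truncn x)%:R + 1.
Proof. by move=> x0; have /andP[-> ] := truncn_itv x0; rewrite -addn1 natrD. Qed.

Lemma expR_le_ln (R : realType) (t x : R) : 0 < x -> (expR t <= x) = (t <= ln x).
Proof. by move=> x0; rewrite -[X in expR t <= X]lnK ?posrE // ler_expR. Qed.

Lemma le_expR_ln (R : realType) (t x : R) : 0 < x -> (x <= expR t) = (ln x <= t).
Proof. by move=> x0; rewrite -[X in X <= expR t]lnK ?posrE // ler_expR. Qed.

Lemma smooth_seq_lower (R : realType) (x y K L M : R) :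
  L = ln x -> M = ln L -> 1 <= M -> 8 <= K -> K <= L -> 2 <= y -> y <= x ->
  K * L <= y ->
  expR (L / (4 * M) * ln (K / 8)) <=
  (size (smooth_seq (Num.truncn x) (Num.truncn y)))%:R.
Proof.
move=> EL EM M1 K8 KL y2 yx KLy.
have x0 : 0 < x by lra.
have L8 : 8 <= L by lra.
have L0 : 0 < L by lra.
pose w := Num.min y (L ^+ 2).
(* The cut-off at [L ^+ 2] does no harm here, since [K <= L]. *)
have KLw : K * L <= w by rewrite /w le_min KLy /=; nra.
have wy : w <= y by rewrite /w ge_min lexx.
have wL : w <= L ^+ 2 by rewrite /w ge_min lexx orbT.
have w64 : 64 <= w by nra.
have [|qw wq] := @truncn_bounds R w; first lra.
set q := Num.truncn w in qw wq.
have q2 : 2 <= q%:R :> R by lra.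
have q0 : 0 < q%:R :> R by lra.
have qn : (0 < q)%N by rewrite -(ltr_nat R).
have lq : 2^-1 <= ln (q%:R : R).
  apply: le_trans (ln2_ge_half R) _; rewrite ler_ln ?posrE //.
have lqL : ln (q%:R : R) <= L by rewrite EL ler_ln ?posrE //; lra.
have lqM : ln (q%:R : R) <= 2 * M.
  have -> : 2 * M = ln (L ^+ 2) by rewrite lnXn // -EM mulr_natl.
  by rewrite ler_ln ?posrE ?exprn_gt0 //; lra.
have lq0 : 0 < ln (q%:R : R) by lra.
pose u := L / ln (q%:R : R).
have u1 : 1 <= u by rewrite /u ler_pdivlMr // mul1r.
have [|ku uk] := @truncn_bounds R u; first lra.
set k := Num.truncn u in ku uk.
have k1 : 1 <= k%:R :> R by rewrite ler1n /k truncn_gt0.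
have kL : k%:R * ln (q%:R : R) <= L by rewrite -ler_pdivlMr.
(* One factor 2 comes from [ln q <= 2 * M], the other from rounding: [u < k + 1 <= 2 * k]. *)
have kM : L / (4 * M) <= k%:R.
  have : L / (2 * M) <= u by rewrite /u ler_pM2l // lef_pV2 ?posrE //; lra.
  have -> : L / (2 * M) = 2 * (L / (4 * M)) by field; lra.
  by lra.
pose P := #|small_primes q|.
(* Chebyshev gives P ln q >= (q - 1) / 4, while k ln q <= L and K L < q + 1. The 8 collects 2 from
   halving [q], 2 from ln 2 >= 1/2, and 2 that absorbs the rounding. *)
have PK : K / 8 * k%:R <= P%:R.
  have : (2 ^ q./2)%:R <= (q ^ P)%:R :> R by rewrite ler_nat expn2_half_le_small_primes.
  rewrite -ler_ln ?posrE ?ltr0n ?expn_gt0 ?qn //.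
  rewrite !natrX !lnXn // -[_ *+ q./2]mulr_natl -[_ *+ P]mulr_natl => H.
  have h2 : q%:R <= 2 * (q./2)%:R + 1 :> R.
    by rewrite -natrM natr1 ler_nat -addn1 -{1}[q]odd_double_half -mul2n addnC leq_add2l leq_b1.
  have := ln2_ge_half R; have : 0 <= (q./2)%:R :> R by [].
  move=> h0 l2; rewrite -(ler_pM2r lq0); nra.
have k0 : 0 < k%:R :> R by lra.
have K80 : 1 <= K / 8 by lra.
have kP : (k <= P)%N by rewrite -(ler_nat R) (le_trans _ PK) // ler_peMl // ltW.
apply: (@le_trans _ _ ((K / 8) ^+ k)).
  have lK := ln_ge0 K80.
  have K80' : 0 < K / 8 by lra.
  by rewrite expR_le_ln ?exprn_gt0 // lnXn // -[_ *+ k]mulr_natl ler_wpM2r.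
apply: (@le_trans _ _ ('C(P, k))%:R).
  rewrite -(@ler_pM2r _ (k%:R ^+ k)) ?exprn_gt0 // -exprMn.
  apply: (@le_trans _ _ (P%:R ^+ k)); first by rewrite lerXn2r ?nnegrE //; nra.
  by rewrite -!natrX -natrM ler_nat mulnC expn_bin_le.
rewrite ler_nat; apply: smooth_seq_ge_bin.
  by rewrite qn le_truncn.
have x0' : 0 <= x by lra.
rewrite truncn_ge_nat // natrX -ler_ln ?posrE ?exprn_gt0 //.
by rewrite lnXn // -[_ *+ k]mulr_natl -EL.
Qed.

(** With [T] near sqrt L, the small primes contribute [b ^ T <= exp (2 M T) <= exp (L / M)]. The
    large ones contribute [2 ^ e], and [T ^ e <= x ^+ 2] forces [e <= 4 * (L / M)]. Hence the
    constant 5. *)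
Lemma size_divisors_asymp (R : realType) (x L M : R) (n : nat) :
  L = ln x -> M = ln L -> 864 <= M -> 0 < x -> 1 <= L -> (0 < n)%N -> n%:R <= x ^+ 2 ->
  (size (divisors n))%:R <= expR (5 * (L / M)).
Proof.
move=> EL EM M8 x0 L1 n0 nx.
have n0' : 0 < n%:R :> R by rewrite ltr0n.
have L0 : 0 < L by lra.
have M0 : 0 < M by lra.
have lnn : ln (n%:R : R) <= 2 * L.
  have -> : 2 * L = ln (x ^+ 2) by rewrite lnXn // -EL mulr_natl.
  by rewrite ler_ln ?posrE ?exprn_gt0.
(* E = sqrt L; rounded up, it is the cut-off T between small and large primes. *)
pose E := expR (M / 2).
have E0 : 0 < E by apply: expR_gt0.
have EE : E ^+ 2 = L.
  by rewrite /E -expRM_natl mulrC divfK // EM lnK ?posrE.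
(* Since exp (M / 2) >= (M / 6)^3 = (M / 216) M^2, it suffices that M >= 4 * 216 = 864. *)
have EM3 : 4 * M ^+ 2 <= E.
  have -> : E = expR (M / 6) ^+ 3 by rewrite /E -expRM_natl; congr expR; lra.
  have h := expR_ge1Dx (M / 6).
  apply: (@le_trans _ _ ((M / 6) ^+ 3)); last by rewrite lerXn2r ?nnegrE //; lra.
  have -> : (M / 6) ^+ 3 = M / 216 * M ^+ 2 by field.
  by rewrite ler_wpM2r ?sqr_ge0 //; lra.
have M2 : 864 <= M ^+ 2 by rewrite expr2; nra.
have E9 : 9 <= E by lra.
have L9 : 9 <= L by rewrite -EE expr2; nra.
(* Every exponent a in [n] satisfies 2^a <= n; the successor makes the bound strict, as
   [size_divisors_le] requires. *)
pose b := (trunc_log 2 n).+1.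
have nb p : (logn p n < b)%N.
  rewrite /b ltnS; have [pp|pp] := boolP (prime p); last first.
    by rewrite lognE (negbTE pp).
  apply: trunc_log_max => //.
  apply: leq_trans (dvdn_leq n0 (pfactor_dvdnn p n)).
  by case: (logn p n) => // a; rewrite leq_exp2r // prime_gt1.
pose T := (Num.truncn E).+1.
have [|TE ET] := @truncn_bounds R E; first lra.
have TE' : T%:R <= E + 1 by rewrite /T -natr1 lerD2r.
have ET' : E <= T%:R by rewrite /T -natr1; exact: ltW.
have lT : M / 2 <= ln (T%:R : R) by rewrite -expR_le_ln ?ltr0n.
have l2 := ln2_ge_half R.
have bL : b%:R <= L ^+ 2.
  have : (2 ^ trunc_log 2 n)%:R <= n%:R :> R by rewrite ler_nat trunc_logP.
  rewrite -ler_ln ?posrE ?ltr0n ?expn_gt0 // natrX lnXn // -[_ *+ _]mulr_natl => h.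
  have t0 : 0 <= (trunc_log 2 n)%:R :> R by [].
  rewrite /b -natr1; nra.
have lb : ln (b%:R : R) <= 2 * M.
  have -> : 2 * M = ln (L ^+ 2) by rewrite lnXn // -EM mulr_natl.
  by rewrite ler_ln ?posrE ?exprn_gt0 ?ltr0n.
have lb0 : 0 <= ln (b%:R : R) by rewrite ln_ge0 // ler1n.
have [e Te De] := @size_divisors_le n b T n0 isT nb.
have eM : e%:R <= 4 * (L / M).
  have : ln ((T ^ e)%:R : R) <= ln n%:R.
    by rewrite ler_ln ?posrE ?ltr0n ?expn_gt0 // ler_nat.
  rewrite natrX lnXn ?ltr0n // -[_ *+ _]mulr_natl => h.
  have e0 : 0 <= e%:R :> R by [].
  have -> : 4 * (L / M) = (4 * L) / M by rewrite mulrA.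
  rewrite ler_pdivlMr //; nra.
(* By [EM3], 2 M^2 <= E / 2, and (E + 1) E / 2 <= E^2 = L. *)
have TL : T%:R * (2 * M) <= L / M.
  by rewrite ler_pdivlMr // -EE; nra.
apply: (@le_trans _ _ ((b ^ T * 2 ^ e)%:R)); first by rewrite ler_nat.
rewrite le_expR_ln ?ltr0n ?muln_gt0 ?expn_gt0 //.
rewrite natrM !natrX lnM ?posrE ?exprn_gt0 ?ltr0n // !lnXn ?ltr0n //.
rewrite -[_ *+ T]mulr_natl -[_ *+ e]mulr_natl.
have h1 : T%:R * ln (b%:R : R) <= T%:R * (2 * M) by rewrite ler_wpM2l.
have h2 : e%:R * ln (2 : R) <= e%:R.
  by rewrite ler_piMr // -[2]/(1 + 1) le_ln1Dx; lra.
lra.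
Qed.

(** * Transfer from integer sets to lists of naturals, and the final comparison *)

Lemma card_imfset2_le (A : {fset int}) (g : int -> int -> int) :
  (#|` [fset g a b | a in A, b in A]%fset| <= #|` A| ^ 2)%N.
Proof.
rewrite unlock size_seq_fset (leq_trans (size_undup _)) //.
by rewrite size_allpairs mulnn.
Qed.

Lemma mem_smooth_set (R : realType) (x y : R) (z : int) : 0 <= x -> 0 <= y ->
  (z \in smooth_set x y) =
  (z \in map Posz (smooth_seq (Num.truncn x) (Num.truncn y))).
Proof.
move=> x0 y0; apply/smooth_setP/mapP => [[]|[n]].
  case: z => // n n1 nx ny; exists n => //.
  by rewrite mem_smooth_seq !truncn_ge_nat // ny andbT; exact/andP.
rewrite mem_smooth_seq !truncn_ge_nat // => /and3P[n0 nx ny] ->.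
by split.
Qed.

Lemma card_smooth_set (R : realType) (x y : R) : 0 <= x -> 0 <= y ->
  (#|` smooth_set x y| = size (smooth_seq (Num.truncn x) (Num.truncn y)))%N.
Proof.
move=> x0 y0; rewrite -(size_map Posz); apply/perm_size/uniq_perm.
- exact: fset_uniq.
- by rewrite map_inj_uniq ?filter_uniq ?iota_uniq // => ? ? [].
- by move=> z; rewrite mem_smooth_set.
Qed.

Lemma card_prodset_smooth (R : realType) (x y : R) (s : seq nat) : 0 <= x -> 0 <= y ->
  s = smooth_seq (Num.truncn x) (Num.truncn y) ->
  (size (undup [seq a * b | a <- s, b <- s]%N) <= #|` prodset (smooth_set x y)|)%N.
Proof.
move=> x0 y0 Es; rewrite -(size_map Posz); apply: uniq_leq_size.
  by rewrite map_inj_uniq ?undup_uniq // => ? ? [].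
move=> z /mapP[n]; rewrite mem_undup => /allpairsP[[a b] /= [sa sb ->]] ->.
rewrite PoszM; apply: in_imfset2 => /=; rewrite mem_smooth_set // -Es map_f //.
Qed.

Theorem theorem2 (R : realType) (f : R -> R)
    (hf : f x @[x --> +oo] --> +oo) :
  erdos_szemeredi R (smooth_collection f).
Proof.
move=> e e0.
pose K : R := Num.max 8 (8 * expR (20 / e)).
have K8 : 8 <= K by rewrite /K le_max lexx.
have Ke : 20 / e <= ln (K / 8).
  have K0 : 0 < K / 8 by lra.
  by rewrite -expR_le_ln // ler_pdivlMr // mulrC /K le_max lexx orbT.
have [X [_ fX]] : \forall x \near +oo, K <= f x by move/cvgryPge : hf; apply.
pose L0 := Num.max K (expR 864).
pose X0 := Num.max X (expR L0).
(* As [S(x, y)] has at most x elements, this size forces [x > X0], hence both [K <= f x] and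
   [L0 <= ln x]. *)
exists (Num.truncn X0).+1 => A [x [y [y2 fy yx ->]]].
set A0 := smooth_set x y => NA.
have x0 : 0 <= x by lra.
have y0 : 0 <= y by lra.
have cA := card_smooth_set _ _ _ x0 y0; rewrite -/A0 in cA.
set s := smooth_seq _ _ in cA.
have sx : (size s)%:R <= x.
  rewrite -truncn_ge_nat // (leq_trans (size_subseq (filter_subseq _ _))) //.
  by rewrite size_iota.
have xX0 : X0 < x.
  by apply: lt_le_trans sx; apply: lt_le_trans (truncnS_gt _) _; rewrite -cA ler_nat.
have Kf : K <= f x by apply: fX; apply: le_lt_trans xX0; rewrite /X0 le_max lexx.
pose L := ln x; pose M := ln L.
have x0' : 0 < x by lra.
have LL : L0 <= L.
  by rewrite /L -expR_le_ln //; apply: ltW; apply: le_lt_trans xX0; rewrite /X0 le_max lexx orbT.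
have KL : K <= L by apply: le_trans LL; rewrite /L0 le_max lexx.
have L0' : 0 < L by lra.
have M864 : 864 <= M.
  by rewrite /M -expR_le_ln //; apply: le_trans LL; rewrite /L0 le_max lexx orbT.
have KLy : K * L <= y by apply: le_trans fy; rewrite ler_wpM2r // ltW.
have M1 : 1 <= M by lra.
have lo := smooth_seq_lower _ _ _ _ _ _ erefl erefl M1 K8 KL y2 yx KLy.
rewrite -/L -/M -/s -cA in lo.
have s0 n : n \in s -> (0 < n)%N by rewrite mem_smooth_seq => /andP[].
have sle n : n \in s -> n%:R <= x.
  by rewrite mem_smooth_seq truncn_ge_nat // => /and3P[].
pose D := expR (5 * (L / M)).
have sD a b : a \in s -> b \in s -> (size (divisors (a * b)) <= Num.truncn D)%N.
  move=> sa sb; rewrite truncn_ge_nat ?expR_ge0 //.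
  apply: (@size_divisors_asymp _ x) => //; first lra.
    by rewrite muln_gt0 !s0.
  by rewrite natrM expr2 ler_pM // sle.
have us : uniq s by rewrite filter_uniq ?iota_uniq.
have := size_sqr_le_prod _ _ us s0 sD; set P := size (undup _) => sq.
(* The 20 in [K] is 5 * 4: the 5 of the divisor bound times the 4 in [L / (4 * M)]. *)
have DA : D <= #|` A0|%:R `^ e.
  apply: (@le_trans _ _ (expR (L / (4 * M) * ln (K / 8)) `^ e)).
    rewrite -expRM ler_expR.
    have -> : 5 * (L / M) = L / (4 * M) * (20 / e) * e by field; lra.
    rewrite ler_wpM2r ?(ltW e0) // ler_wpM2l // divr_ge0 //; lra.
  by rewrite ge0_ler_powR ?nnegrE ?expR_ge0 ?(ltW e0).
have A1 : 1 <= #|` A0|%:R :> R by rewrite ler1n (leq_trans _ NA).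
have A0' : 0 < #|` A0|%:R :> R by lra.
have sqR : #|` A0|%:R `^ 2 = (#|` A0| ^ 2)%N%:R :> R.
  by rewrite natrX -powR_mulrn // ltW.
move=> m; split.
  apply: (@le_trans _ _ P%:R); last first.
    rewrite ler_nat leq_max; apply/orP; right.
    exact: card_prodset_smooth.
  (* Dividing out [|A|^e] leaves |A|^2 <= P |A|^e, which follows from [sq] and [DA]. *)
  rewrite powRB ?(gt_eqF A0') ?implybT // ler_pdivrMr ?powR_gt0 // sqR cA.
  apply: (@le_trans _ _ (P * Num.truncn D)%N%:R); first by rewrite ler_nat.
  rewrite natrM ler_wpM2l // -cA; apply: le_trans DA.
  by have [] := @truncn_bounds R D (expR_ge0 _).
apply: (@le_trans _ _ (#|` A0|%:R `^ 2)).
  by rewrite sqR ler_nat geq_max !card_imfset2_le.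
by rewrite ler_powR // lerDl ltW.
Qed.
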